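(* There is a polynomial $p$ such that the following holds. For any $n\ge1$, any non-empty $X\subseteq\{0,1\}^n$ with $P=\operatorname{conv}(X)$, and any $\varepsilon>0$, there exists a polytope $Q=\{(x,y)\in\mathbb{R}^n\times\mathbb{R}^{\operatorname{xc}(P)}\mid Bx+Cy\le d\}$ with $B\in\mathbb{Q}^{(4\operatorname{xc}(P)+2n)\times n}$, $C\in\mathbb{Q}^{(4\operatorname{xc}(P)+2n)\times\operatorname{xc}(P)}$, $d\in\mathbb{Q}^{4\operatorname{xc}(P)+2n}$ of total encoding length at most $p(n,\operatorname{xc}(P),\log(1/\varepsilon))$, such that $P\subseteq\operatorname{proj}_x(Q)\subseteq P+\varepsilon$. Furthermore, for every $c\in\mathbb{R}^n$, $\max\{c^Tx\mid x\in\operatorname{proj}_x(Q)\}-\max\{c^Tx\mid x\in P\}\le\varepsilon\|c\|_2$.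
   Context: $\operatorname{proj}_x(Q)=\{x\in\mathbb{R}^n\mid\exists y:(x,y)\in Q\}$. $P+\varepsilon=\{x+z\mid x\in P,\ \|z\|_2\le\varepsilon\}$. For a polytope $P$, an extension is a polyhedron $Q'\subseteq\mathbb{R}^m$ with a linear map $\pi$ such that $\pi(Q')=P$; an extended formulation is a description $Q'=\{z\mid C'z\le c',\ D'z=d'\}$, whose size is the number of inequalities; $\operatorname{xc}(P)$ is the minimum size of an extended formulation of $P$. *)

(* Defs.v *)
From HB Require Import structures.
From mathcomp Require Import all_boot all_order all_algebra.
From mathcomp Require Import boolp classical_sets reals exp.
From mathcomp Require Import Rstruct.
From Stdlib Require Import Rdefinitions.

Set Implicit Arguments.
Unset Strict Implicit.
Unset Printing Implicit Defensive.

Import Order.TTheory GRing.Theory Num.Theory.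
Local Open Scope ring_scope.
Local Open Scope classical_set_scope.

Notation RR := Rdefinitions.R.

Definition embed01 (n : nat) (v : 'cV[bool]_n) : 'cV[RR]_n :=
  map_mx (fun b : bool => (b : nat)%:R) v.

Definition conv01 (n : nat) (X : {set 'cV[bool]_n}) : set 'cV[RR]_n :=
  [set x | exists lam : 'cV[bool]_n -> RR,
      (forall v, v \in X -> 0 <= lam v) /\
      \sum_(v in X) lam v = 1 /\
      x = \sum_(v in X) lam v *: embed01 v].

Definition norm2 (n : nat) (z : 'cV[RR]_n) : RR :=
  Num.sqrt (\sum_(i < n) z i 0 ^+ 2).
Definition dotv (n : nat) (c x : 'cV[RR]_n) : RR := \sum_(i < n) c i 0 * x i 0.

Definition ball_sum (n : nat) (P : set 'cV[RR]_n) (eps : RR) : set 'cV[RR]_n :=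
  [set w | exists x z, P x /\ norm2 z <= eps /\ w = x + z].

Definition has_ext_form (n : nat) (P : set 'cV[RR]_n) (k : nat) : Prop :=
  exists (m l : nat) (C' : 'M[RR]_(k, m)) (c' : 'cV[RR]_k)
         (D' : 'M[RR]_(l, m)) (d' : 'cV[RR]_l) (pi : 'M[RR]_(n, m)),
    [set pi *m z | z in
       [set z : 'cV[RR]_m | (forall i, (C' *m z) i 0 <= c' i 0) /\ D' *m z = d']]
    = P.

(* xc(P): minimum size of an extended formulation of P (0 if none exists,
   which never happens for polytopes). *)
Definition xc (n : nat) (P : set 'cV[RR]_n) : nat :=
  match pselect (exists k, `[< has_ext_form P k >]) with
  | left h => ex_minn h
  | right _ => 0%N
  end.

(* Encoding lengths (Schrijver's conventions):
   <z> = 1 + ceil(log2(|z|+1)) for integers, <p/q> = 1 + ceil(log2(|p|+1))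
   + ceil(log2(q+1)) for rationals in lowest terms, and
   <A> = m*n + sum of <a_ij> for an m x n rational matrix. *)
Definition enc_rat (r : rat) : nat :=
  (1 + up_log 2 (absz (numq r) + 1) + up_log 2 (absz (denq r) + 1))%N.
Definition enc_mx (m k : nat) (A : 'M[rat]_(m, k)) : nat :=
  (m * k + \sum_(i < m) \sum_(j < k) enc_rat (A i j))%N.

Definition poly3 := seq (RR * (nat * nat * nat)).
Definition eval3 (p : poly3) (a b c : RR) : RR :=
  \sum_(t <- p) t.1 * a ^+ t.2.1.1 * b ^+ t.2.1.2 * c ^+ t.2.2.

Definition polyQ (n k r : nat) (B : 'M[rat]_(r, n)) (C : 'M[rat]_(r, k))
    (d : 'cV[rat]_r) (x : 'cV[RR]_n) (y : 'cV[RR]_k) : Prop :=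
  forall i, (map_mx ratr B *m x + map_mx ratr C *m y) i 0 <= ratr (d i 0).

Definition projQ (n k r : nat) (B : 'M[rat]_(r, n)) (C : 'M[rat]_(r, k))
    (d : 'cV[rat]_r) : set 'cV[RR]_n :=
  [set x | exists y, polyQ B C d x y].

(* Q is bounded (hence, being a polyhedron, a polytope). *)
Definition boundedQ (n k r : nat) (B : 'M[rat]_(r, n)) (C : 'M[rat]_(r, k))
    (d : 'cV[rat]_r) : Prop :=
  exists M : RR, forall x y, polyQ B C d x y ->
    (forall i, `|x i 0| <= M) /\ (forall j, `|y j 0| <= M).

(* Main.v *)
Require Import Defs.
From HB Require Import structures.
From mathcomp Require Import all_boot all_order all_algebra.
From mathcomp Require Import boolp classical_sets reals exp.
From mathcomp Require Import Rstruct.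
From mathcomp Require Import sequences.
From mathcomp Require Import lra ring zify.

Set Implicit Arguments.
Unset Strict Implicit.
Unset Printing Implicit Defensive.

Import Order.TTheory GRing.Theory Num.Theory.
Local Open Scope ring_scope.
Local Open Scope classical_set_scope.

(** An extended formulation of size [k] lifts every vertex [v] of [P] to a point
    [(v, s v)] with [s v >= 0] (its slacks), and [P] is the projection of
    [L `&` (s >= 0)], where [L] is the affine hull of the lifted vertices.
    Rescale so that each coordinate of [s] has maximum 1 over the vertices.  By
    Farkas, [max_P c - c x] equals [f s] on [L] for some [f >= 0], and evaluating
    at a vertex where [s i = 1] shows that [f i] is at most the l1-norm of [c]:
    the duals are bounded independently of [L].  Hence any point with [s >= 0]
    that nearly satisfies the equations of [L], written as [Pi (w - w0) = 0] with
    [Pi] an orthogonal projection, nearly satisfies every valid inequality of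
    [P], so by Farkas again its projection is near [P].  It remains to multiply
    [Pi] by a power of two and round it to integers; relaxing the [n + k] rounded
    equations to two-sided inequalities and adding [0 <= s <= 1] gives [4k + 2n]
    rows. *)

(** * Farkas' lemma and an orthogonal projection with bounded entries *)

(** Induction on the number of columns. Either the first column [a] gets weight 0, or some [y1]
    separates [b] from the cone of the other columns. In the second case [y1] is negative on [a],
    and the problem is projected along [a]. *)
Lemma farkas (R : realFieldType) (N k : nat) (A : 'M[R]_(N, k)) (b : 'cV[R]_N) :
  (forall y : 'rV_N, (forall j, 0 <= (y *m A) 0 j) -> 0 <= (y *m b) 0 0) ->
  exists2 f : 'cV[R]_k, (forall j, 0 <= f j 0) & A *m f = b.
Proof.
elim: k A b => [|k IHk] A b Ab.
  exists 0 => [|]; first by case.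
  rewrite mulmx0; apply/colP => i; rewrite mxE.
  have Ab0 (y : 'rV_N) : 0 <= (y *m b) 0 0 by apply: Ab; case.
  apply/eqP; rewrite eq_le; apply/andP; split.
    by have := Ab0 (delta_mx 0 i); rewrite -rowE mxE.
  by have := Ab0 (- delta_mx 0 i); rewrite mulNmx -rowE !mxE oppr_ge0.
have Aab := hsubmxK (A : 'M_(N, 1 + k)).
set a := lsubmx _ in Aab; set A' := rsubmx _ in Aab.
have AE (y : 'rV_N) : y *m (A : 'M_(N, 1 + k)) = row_mx (y *m a) (y *m A').
  by rewrite -[in LHS]Aab mul_mx_row.
have {}Ab (y : 'rV_N) : 0 <= (y *m a) 0 0 -> (forall j, 0 <= (y *m A') 0 j) ->
    0 <= (y *m b) 0 0.
  move=> ya yA; apply: Ab => j; rewrite (AE y) mxE.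
  by case: splitP => l _; rewrite ?ord1.
have sol (f0 : R) (f : 'cV_k) :
    0 <= f0 -> (forall j, 0 <= f j 0) -> A' *m f + f0 *: a = b ->
    exists2 f : 'cV[R]_k.+1, (forall j, 0 <= f j 0) & A *m f = b.
  move=> f0_ge0 f_ge0 Af; exists (col_mx (f0%:M : 'M_1) f : 'cV_(1 + k)).
    by move=> j; rewrite mxE; case: splitP => l _ //; rewrite ord1 mxE eqxx.
  rewrite -Aab; apply: etrans (mul_row_col a A' (f0%:M : 'M_1) f) _.
  by rewrite mul_mx_scalar addrC.
have [A'b|] := pselect (forall y : 'rV_N, (forall j, 0 <= (y *m A') 0 j) ->
    0 <= (y *m b) 0 0).
  have [f f_ge0 Af] := IHk A' b A'b.
  by apply: (sol 0 f) => //; rewrite scale0r addr0.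
move=> /existsNP[y1 /not_implyP[y1A /negP]]; rewrite -ltNge => y1b.
have y1a : (y1 *m a) 0 0 < 0.
  by rewrite ltNge; apply/negP => y1a; have := Ab _ y1a y1A; rewrite leNgt y1b.
set t := - ((y1 *m a) 0 0)^-1.
have t_gt0 : 0 < t by rewrite oppr_gt0 invr_lt0.
pose y0 := t *: y1.
have y0a : y0 *m a = - 1%:M.
  apply/matrixP=> i j; rewrite !ord1 -scalemxAl mxE mulNr mulVf ?lt_eqF //.
  by rewrite !mxE eqxx.
have y0A j : 0 <= (y0 *m A') 0 j by rewrite -scalemxAl mxE mulr_ge0 // ltW.
have y0b : (y0 *m b) 0 0 < 0 by rewrite -scalemxAl mxE pmulr_rlt0.
(* Project [A'] and [b] along [a] onto the hyperplane [y0 = 0]. *)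
have [y|f f_ge0 Af] := IHk (A' + a *m (y0 *m A')) (b + a *m (y0 *m b)).
  rewrite !mulmxDr !mulmxA -!mulmxDl => yA; apply: Ab yA.
  by rewrite mulmxDl -mulmxA y0a mulmxN mulmx1 subrr mxE.
(* Collecting the multiples of [a] in [Af] gives this weight. It is nonnegative because [y0] is
   nonnegative on [A'] and negative on [b]. *)
apply: (sol ((y0 *m A' *m f) 0 0 - (y0 *m b) 0 0) f) => //.
  rewrite subr_ge0 (le_trans (ltW y0b)) // mxE sumr_ge0 // => j _.
  by rewrite mulr_ge0.
move: Af; rewrite mulmxDl -[a *m _ *m f]mulmxA => Af.
rewrite scalerBl -!mul_mx_scalar -!mx11_scalar addrA Af.
by rewrite addrK.
Qed.

(** [Pi] projects onto the orthogonal complement of the columns of [D]. Being symmetric and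
    idempotent, it satisfies [Pi i i = \sum_j Pi i j ^+ 2], which bounds every entry by 1 however
    ill-conditioned [D] is. *)
Lemma orthogonal_projection (R : realFieldType) (N q : nat) (D : 'M[R]_(N, q)) :
  exists Pi : 'M[R]_N, [/\ Pi *m D = 0,
    forall g : 'rV_N, g *m D = 0 -> g *m Pi = g & forall i j, `|Pi i j| <= 1].
Proof.
(* A basis, and not [D^T] itself, makes the Gram matrix [G] invertible. *)
pose E := row_base D^T.
have freeE : row_free E by exact: row_base_free.
have [Y DE] : exists Y, D^T = Y *m E by apply/submxP; rewrite eq_row_base.
have [Z ED] : exists Z, E = Z *m D^T by apply/submxP; rewrite eq_row_base.
clearbody E.
have sq0 (m : nat) (z : 'rV[R]_m) : z *m z^T = 0 -> z = 0.
  move/matrixP/(_ 0 0); rewrite !mxE => /eqP.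
  rewrite psumr_eq0 => [/allP z0|j _]; last by rewrite mxE -expr2 sqr_ge0.
  apply/rowP => j; have := z0 j; rewrite mem_index_enum => /(_ isT).
  by rewrite !mxE -expr2 sqrf_eq0 => /eqP.
pose G := E *m E^T.
have Gunit : G \in unitmx.
  rewrite -row_free_unit; apply: inj_row_free => v vG.
  apply/eqP; rewrite -(mulmx_free_eq0 _ freeE); apply/eqP/sq0.
  by rewrite trmx_mul mulmxA -[v *m E *m _]mulmxA vG mul0mx.
pose Pi := 1%:M - E^T *m invmx G *m E.
have PiE : Pi *m E^T = 0.
  by rewrite mulmxBl mul1mx -!mulmxA -/G mulVmx // mulmx1 subrr.
have PiT : Pi^T = Pi.
  by rewrite linearB /= trmx1 !trmx_mul trmx_inv trmx_mul !trmxK mulmxA.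
have Pi2 : Pi *m Pi = Pi.
  by rewrite {2}/Pi mulmxBr mulmx1 !mulmxA PiE !mul0mx subr0.
have PiD i : Pi i i = \sum_j Pi i j ^+ 2.
  rewrite -[in LHS]Pi2 mxE; apply: eq_bigr => j _.
  by rewrite expr2; congr (_ * _); rewrite -{1}PiT [LHS]mxE.
have Pi_le i j : Pi i j ^+ 2 <= Pi i i.
  by rewrite PiD (bigD1 j) //= lerDl sumr_ge0 // => l _; rewrite sqr_ge0.
have Pi_le1 i : Pi i i <= 1.
  rewrite leNgt; apply/negP => Pi_gt1; have := Pi_le i i.
  by rewrite leNgt expr2 ltr_pMr ?Pi_gt1 // (lt_trans ltr01).
exists Pi; split=> [|g gD|i j].
- by rewrite -[D]trmxK DE trmx_mul mulmxA PiE mul0mx.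
- have gE : g *m E^T = 0 by rewrite ED trmx_mul trmxK mulmxA gD mul0mx.
  by rewrite mulmxBr mulmx1 !mulmxA gE !mul0mx subr0.
- rewrite -(@ler_pXn2r _ 2) // ?nnegrE // expr1n -normrX ger0_norm ?sqr_ge0 //.
  exact: le_trans (Pi_le i j) (Pi_le1 i).
Qed.

(** * Slack liftings: bounded duals and robust support inequalities *)

Definition norm1 (R : numDomainType) (n : nat) (c : 'rV[R]_n) : R :=
  \sum_(i < n) `|c 0 i|.

Definition hull (R : numDomainType) (n q : nat) (U : 'M[R]_(n, q)) (x : 'cV[R]_n) :
    Prop :=
  exists lam : 'cV[R]_q,
    [/\ forall j, 0 <= lam j 0, \sum_j lam j 0 = 1 & x = U *m lam].

Lemma norm1_ge0 (R : numDomainType) (n : nat) (c : 'rV[R]_n) : 0 <= norm1 c.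
Proof. by apply: sumr_ge0 => i _; rewrite normr_ge0. Qed.

Lemma mulmx_norm1_le (R : realFieldType) (n : nat) (c : 'rV[R]_n) (x : 'cV[R]_n) (t : R) :
  (forall i, `|x i 0| <= t) -> `|(c *m x) 0 0| <= norm1 c * t.
Proof.
move=> xt; rewrite mxE (le_trans (ler_norm_sum _ _ _)) // /norm1 mulr_suml.
by apply: ler_sum => i _; rewrite normrM ler_wpM2l.
Qed.

Lemma hull_le (R : realFieldType) (n q : nat) (U : 'M[R]_(n, q)) (x : 'cV[R]_n)
    (c : 'rV[R]_n) (beta : R) :
  hull U x -> (forall j, (c *m U) 0 j <= beta) -> (c *m x) 0 0 <= beta.
Proof.
move=> [lam [lam_ge0 lam1 ->]] cU; rewrite mulmxA mxE.
rewrite -[leRHS]mulr1 -lam1 mulr_sumr; apply: ler_sum => j _.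
by rewrite ler_wpM2r.
Qed.

(* Column [j] of [S] is the slack vector of the vertex in column [j] of [U]. *)
Record lifting (R : realFieldType) (n k q : nat) (U : 'M[R]_(n, q))
    (S : 'M[R]_(k, q)) : Prop := Lifting {
  lifting_box : forall i j, 0 <= U i j <= 1;
  lifting_slack : forall i j, 0 <= S i j <= 1;
  lifting_normalised : forall i, (exists j, S i j = 1) \/ (forall j, S i j = 0);
  lifting_hull : forall mu : 'cV_q, \sum_j mu j 0 = 1 ->
    (forall i, 0 <= (S *m mu) i 0) -> hull U (U *m mu)
}.

(** The multipliers [f] come from Farkas. Its hypothesis concerns weights [y] with [S y >= 0]; it
    follows from [lifting_hull], since [c] is at most [beta] on the hull. *)
Lemma lifting_dual (R : realFieldType) (n k q : nat) (U : 'M[R]_(n, q))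
    (S : 'M[R]_(k, q)) (c : 'rV[R]_n) (j0 : 'I_q) :
  lifting U S -> (forall j, (c *m U) 0 j <= (c *m U) 0 j0) ->
  exists2 f : 'rV[R]_k, forall i, 0 <= f 0 i <= norm1 c &
    forall j, (c *m U) 0 j + (f *m S) 0 j = (c *m U) 0 j0.
Proof.
move=> [U01 S01 S1 SU] cU; set beta := (c *m U) 0 j0 in cU *.
pose a := \col_j (beta - (c *m U) 0 j).
(* Adding a large multiple of the maximiser [j0], where [a] vanishes, makes the
   total weight positive, so that [lifting_hull] applies. *)
have [y yS|f f_ge0 fS] := @farkas R q k S^T a.
  set Y := \sum_j y 0 j.
  set T' := 1 + `|Y|; set T := Y + T'.
  have T_gt0 : 0 < T by rewrite /T /T'; have := ler_norm (- Y); rewrite normrN; lra.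
  have T'_ge0 : 0 <= T' by rewrite addr_ge0.
  pose mu : 'cV_q := \col_j (T^-1 * (y 0 j + T' * (j == j0)%:R)).
  have muE (v : 'I_q -> R) :
      \sum_j v j * mu j 0 = T^-1 * ((\sum_j v j * y 0 j) + T' * v j0).
    rewrite [X in _ + X](_ : _ = \sum_j v j * (T' * (j == j0)%:R)); last first.
      rewrite (bigD1 j0) //= eqxx big1 => [|j /negPf->]; last by rewrite !mulr0.
      by rewrite addr0 mulr1 mulrC.
    rewrite -big_split mulr_sumr; apply: eq_bigr => j _ /=.
    by rewrite mxE mulrCA -mulrDr.
  have mu1 : \sum_j mu j 0 = 1.
    have := muE (fun=> 1); rewrite /= mulr1.
    under eq_bigr do rewrite mul1r.
    under [X in _ * (X + _)]eq_bigr do rewrite mul1r.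
    by move=> ->; rewrite mulVf ?gt_eqF.
  have Smu i : 0 <= (S *m mu) i 0.
    rewrite mxE muE mulr_ge0 ?invr_ge0 ?(ltW T_gt0) // addr_ge0 //.
      have := yS i; rewrite mxE; congr (0 <= _); apply: eq_bigr => j _.
      by rewrite mxE mulrC.
    by rewrite mulr_ge0 //; case/andP: (S01 i j0).
  have := hull_le (SU mu mu1 Smu) cU.
  rewrite mulmxA mxE muE mulrC ler_pdivrMr // -/beta => le_beta.
  rewrite mxE; under eq_bigr do rewrite mxE mulrBr.
  rewrite sumrB -mulr_suml -/Y; under [X in _ - X]eq_bigr do rewrite mulrC.
  by move: le_beta; rewrite /T; lra.
(* If row [i] of [S] vanishes then [f i] is unconstrained: replace it by 0. *)
pose f' : 'rV_k := \row_i if `[< exists j, S i j = 1 >] then f i 0 else 0.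
have f'S j : (f' *m S) 0 j = beta - (c *m U) 0 j.
  have /matrixP/(_ j 0) := fS; rewrite !mxE => <-; apply: eq_bigr => i _.
  rewrite !mxE mulrC; case: asboolP => // nS1.
  by case: (S1 i) => // ->; rewrite !mul0r.
exists f' => [i|j]; last by rewrite f'S addrC subrK.
have f'_ge0 l : 0 <= f' 0 l by rewrite mxE; case: ifP.
rewrite f'_ge0 /=; case: (S1 i) => [[j Sij]|Si0]; last first.
  rewrite mxE; case: asboolP => [[j]|_]; rewrite ?norm1_ge0 // Si0 => /eqP.
  by rewrite eq_sym oner_eq0.
(* At a vertex with [S i j = 1] the single term [f' i] is at most the whole gap, and the gap is at
   most [norm1 c] because vertex coordinates lie in [0,1]. *)
apply: (@le_trans _ _ ((f' *m S) 0 j)).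
  rewrite [leRHS]mxE (bigD1 i) //= Sij mulr1 lerDl sumr_ge0 // => l _.
  by rewrite mulr_ge0 //; case/andP: (S01 l j).
rewrite f'S /beta !mxE -sumrB; apply: ler_sum => l _.
rewrite -mulrBr (le_trans (ler_norm _)) // normrM ler_piMr //.
by have /andP[? ?] := U01 l j; have /andP[? ?] := U01 l j0; rewrite ler_norml; lra.
Qed.

Lemma lifting_support (R : realFieldType) (n k q : nat) (U : 'M[R]_(n, q))
    (S : 'M[R]_(k, q)) (Pi : 'M[R]_(n + k)) (j0 : 'I_q) :
  lifting U S ->
  (forall j, Pi *m (col j (col_mx U S) - col j0 (col_mx U S)) = 0) ->
  (forall g : 'rV_(n + k),
     (forall j, g *m (col j (col_mx U S) - col j0 (col_mx U S)) = 0) ->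
     g *m Pi = g) ->
  forall (x : 'cV[R]_n) (s : 'cV[R]_k) (t : R),
  (forall i, 0 <= s i 0) ->
  (forall i, `|(Pi *m (col_mx x s - col j0 (col_mx U S))) i 0| <= t) ->
  forall (c : 'rV[R]_n) (beta : R), (forall j, (c *m U) 0 j <= beta) ->
  (c *m x) 0 0 <= beta + k.+1%:R * norm1 c * t.
Proof.
move=> liftUS PiD gPi x s t s_ge0 Pi_le c beta cU.
have [j1 cUj1] : exists j1, forall j, (c *m U) 0 j <= (c *m U) 0 j1.
  case: (@arg_maxP _ _ _ j0 xpredT (fun j => (c *m U) 0 j)) => // j1 _ j1P.
  by exists j1 => j; exact: j1P.
have [f f01 fS] := lifting_dual liftUS cUj1.
pose g := row_mx c f.
have gW j : (g *m col j (col_mx U S)) = ((c *m U) 0 j1)%:M.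
  apply/matrixP => i l; rewrite !ord1 colE mulmxA -colE mul_row_col mxE.
  by rewrite [RHS]mxE eqxx mulr1n -(fS j) [LHS]mxE.
have gPiE : g *m Pi = g by apply: gPi => j; rewrite mulmxBr !gW subrr.
have t_ge0 : k.+1%:R * norm1 c * t >= norm1 g * t.
  (* Without an index nothing forces [t >= 0], but then both norms vanish. *)
  have [N0|N_gt0] := posnP (n + k).
    have noI (i : 'I_(n + k)) : False by have := ltn_ord i; rewrite [X in (_ < X)%N]N0.
    have -> : norm1 g = 0 by apply: big1 => i; case: (noI i).
    have -> : norm1 c = 0 by apply: big1 => i; case: (noI (lshift k i)).
    by rewrite mulr0 !mul0r.
  apply: ler_wpM2r.
    exact: le_trans (normr_ge0 _) (Pi_le (Ordinal N_gt0)).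
  rewrite /norm1 big_split_ord /= mulrS mulrDl mul1r; apply: lerD.
    by apply: ler_sum => i _; rewrite row_mxEl.
  rewrite -mulr_natl -[k in k%:R]card_ord mulr_natl -sumr_const mulr_suml.
  apply: ler_sum => i _; rewrite row_mxEr mul1r.
  by have /andP[? ?] := f01 i; rewrite ger0_norm.
have := le_trans (ler_norm _) (mulmx_norm1_le g Pi_le).
rewrite mulmxA gPiE mulmxBr gW mul_row_col !mxE eqxx mulr1n.
have : 0 <= \sum_j f 0 j * s j 0.
  by apply: sumr_ge0 => i _; rewrite mulr_ge0 //; case/andP: (f01 i).
have := cU j1; rewrite mxE; lra.
Qed.

(** * Distance to the hull from support inequalities *)

Lemma norm1_row_mx (R : numDomainType) (n k : nat) (c : 'rV[R]_n) (f : 'rV[R]_k) :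
  norm1 (row_mx c f) = norm1 c + norm1 f.
Proof.
rewrite /norm1 big_split_ord /=.
by congr (_ + _); apply: eq_bigr => i _; rewrite ?row_mxEl ?row_mxEr.
Qed.

(** A near point is a nonnegative solution of [U lam + p - r = x], [\sum lam = 1],
    [\sum p + \sum r = eps], and Farkas reduces solvability to the support inequalities. The budget
    can be an equation because, in positive dimension, [p] and [r] can grow together. *)
Lemma support_near_hull (R : realFieldType) (n q : nat) (U : 'M[R]_(n.+1, q))
    (x : 'cV[R]_n.+1) (delta eps : R) :
  0 <= delta -> delta * n.+1%:R <= eps ->
  (forall (c : 'rV[R]_n.+1) (beta : R), (forall j, (c *m U) 0 j <= beta) ->
     (c *m x) 0 0 <= beta + delta * norm1 c) ->
  exists2 p, hull U p & norm1 (x - p)^T <= eps.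
Proof.
move=> delta_ge0 delta_eps xU.
pose A := col_mx (row_mx U (row_mx 1%:M (- 1%:M)))
  (col_mx (row_mx (const_mx 1 : 'rV_q) 0)
          (row_mx 0 (const_mx 1 : 'rV_(n.+1 + n.+1)))).
pose b := col_mx x (col_mx (1%:M : 'M_1) (eps%:M : 'M_1)).
have [y yA|f f_ge0] := @farkas R _ _ A b.
  (* [c], [ga] and [th] are the multipliers of the three groups of equations. The support inequality
     is used for [- c] with bound [ga], and [th] bounds every entry of [c], whence the factor
     [n.+1]. *)
  have [c [ga [th yE]]] : exists c (ga th : 'M_1), y = row_mx c (row_mx ga th).
    by exists (lsubmx y), (lsubmx (rsubmx y)), (rsubmx (rsubmx y)); rewrite !hsubmxK.
  rewrite {y}yE in yA *.
  have cU j : (- c *m U) 0 j <= ga 0 0.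
    have := yA (lshift _ j); rewrite !mul_row_col !mul_mx_row !add_row_mx row_mxEl.
    have -> : ga *m const_mx 1 = const_mx (ga 0 0) :> 'rV_q.
      by apply/rowP => l; rewrite mxE big_ord1 !mxE mulr1.
    rewrite mulNmx mulmx0 addr0 [fun_of_matrix (_ + _) _ _]mxE.
    rewrite [fun_of_matrix (- _) _ _]mxE [fun_of_matrix (const_mx _) _ _]mxE; lra.
  have cth i : `|c 0 i| <= th 0 0.
    have := yA (rshift _ (lshift _ i)); have := yA (rshift _ (rshift _ i)).
    rewrite !mul_row_col !mul_mx_row !add_row_mx !row_mxEr mulmxN.
    have -> : th *m const_mx 1 = const_mx (th 0 0) :> 'rV_(n.+1 + n.+1).
      by apply/rowP => l; rewrite mxE big_ord1 !mxE mulr1.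
    rewrite !mulmx1 mulmx0 add0r -row_mx_const add_row_mx row_mxEr row_mxEl.
    rewrite ![fun_of_matrix (_ + _) _ _]mxE [fun_of_matrix (- _) _ _]mxE.
    by rewrite [fun_of_matrix (const_mx _) _ _]mxE ler_norml; lra.
  have := xU (- c) _ cU; rewrite mulNmx !mul_row_col !mul_mx_scalar !mxE mul1r.
  have c_le : norm1 (- c) <= n.+1%:R * th 0 0.
    rewrite /norm1 -[n.+1 in leRHS]card_ord mulr_natl -sumr_const.
    by apply: ler_sum => i _; rewrite mxE normrN.
  have th_ge0 : 0 <= th 0 0 := le_trans (normr_ge0 _) (cth 0).
  have := ler_wpM2l delta_ge0 c_le; rewrite mulrA.
  have := ler_wpM2r th_ge0 delta_eps; lra.
have [lam [p [r fE]]] : exists lam p r, f = col_mx lam (col_mx p r).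
  by exists (usubmx f), (usubmx (dsubmx f)), (dsubmx (dsubmx f)); rewrite !vsubmxK.
rewrite {f}fE /A in f_ge0 *.
rewrite !mul_col_mx !mul_row_col !mul0mx add0r addr0 mulNmx !mul1mx.
move=> /eq_col_mx[lamU /eq_col_mx[lam1 preps]].
have lam_ge0 j : 0 <= lam j 0 by have := f_ge0 (lshift _ j); rewrite col_mxEu.
have p_ge0 i : 0 <= p i 0.
  by have := f_ge0 (rshift _ (lshift _ i)); rewrite col_mxEd col_mxEu.
have r_ge0 i : 0 <= r i 0.
  by have := f_ge0 (rshift _ (rshift _ i)); rewrite !col_mxEd.
exists (U *m lam).
  exists lam; split=> //.
  move/matrixP/(_ 0 0): lam1; rewrite !mxE eqxx mulr1n => <-.
  by apply: eq_bigr => j _; rewrite mxE mul1r.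
move/matrixP/(_ 0 0): preps; rewrite mxE [RHS]mxE eqxx mulr1n => <-.
rewrite -lamU addrC addKr big_split_ord /= -big_split /=.
apply: ler_sum => i _; rewrite col_mxEu col_mxEd !mxE !mul1r.
by rewrite (le_trans (ler_normB _ _)) // !ger0_norm.
Qed.

(** * Approximate solutions of the rounded equations *)

(** The tolerance is the worst rounding error of a row at a point of the unit cube: 1 for each of
    the [n + k] entries and 1 for the right-hand side. *)
Definition near_solution (R : realFieldType) (n k : nat) (B : 'M[R]_(n + k))
    (b : 'cV[R]_(n + k)) (x : 'cV[R]_n) (s : 'cV[R]_k) : Prop :=
  (forall i, `|(B *m col_mx x s - b) i 0| <= (n + k).+1%:R) /\
  (forall i, 0 <= s i 0 <= 1).

Lemma mulmx_entry_le (R : realFieldType) (N : nat) (A : 'M[R]_N) (w : 'cV[R]_N) :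
  (forall i j, `|A i j| <= 1) -> forall i, `|(A *m w) i 0| <= norm1 w^T.
Proof.
move=> A1 i; rewrite mxE (le_trans (ler_norm_sum _ _ _)) //.
by apply: ler_sum => j _; rewrite normrM mxE ler_piMl.
Qed.

Lemma norm1_tr_le (R : realFieldType) (N : nat) (w : 'cV[R]_N) :
  (forall i, `|w i 0| <= 1) -> norm1 w^T <= N%:R.
Proof.
move=> w1; rewrite /norm1 -[N in leRHS]card_ord -sumr_const.
by apply: ler_sum => i _; rewrite mxE.
Qed.

Lemma near_solution_lift (R : realFieldType) (n k q : nat) (U : 'M[R]_(n, q))
    (S : 'M[R]_(k, q)) (Pi B : 'M[R]_(n + k)) (b : 'cV[R]_(n + k)) (M : R)
    (j j0 : 'I_q) :
  lifting U S ->
  Pi *m (col j (col_mx U S) - col j0 (col_mx U S)) = 0 ->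
  (forall i l, `|B i l - M * Pi i l| <= 1) ->
  (forall i, `|b i 0 - M * (Pi *m col j0 (col_mx U S)) i 0| <= 1) ->
  near_solution B b (col j U) (col j S).
Proof.
move=> [U01 S01 _ _] PiD BPi bPi.
split=> [i|i]; last by rewrite mxE.
rewrite -col_col_mx; set w := col j _ in PiD *; set w0 := col j0 _ in PiD bPi.
have w1 l : `|w l 0| <= 1.
  rewrite !mxE; case: splitP => l' _.
    by have /andP[? ?] := U01 l' j; rewrite ger0_norm.
  by have /andP[? ?] := S01 l' j; rewrite ger0_norm.
have Piw : Pi *m w = Pi *m w0 by apply/eqP; rewrite -subr_eq0 -mulmxBr PiD.
(* The exact equation [Pi w = Pi w0] cancels, leaving only the rounding errors. *)
have -> : B *m w - b = (B - M *: Pi) *m w - (b - M *: (Pi *m w0)).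
  by rewrite mulmxBl -scalemxAl Piw opprB addrA subrK.
have BPi1 i1 i2 : `|(B - M *: Pi) i1 i2| <= 1.
  by have := BPi i1 i2; rewrite !mxE.
rewrite mxE -natr1 (le_trans (ler_normD _ _)) // lerD //.
  exact: le_trans (mulmx_entry_le w BPi1 i) (norm1_tr_le w1).
rewrite mxE normrN; have := bPi i; rewrite ![fun_of_matrix (_ - _) _ _]mxE.
by rewrite ![fun_of_matrix (- _) _ _]mxE ![fun_of_matrix (_ *: _) _ _]mxE.
Qed.

(** The tolerance and the rounding errors add up, divided by the scale [M]. The box bounds only [s],
    so the norm of [x] stays in the estimate. *)
Lemma near_solution_residual (R : realFieldType) (n k : nat)
    (Pi B : 'M[R]_(n + k)) (b : 'cV[R]_(n + k)) (M : R)
    (w0 : 'cV[R]_(n + k)) (x : 'cV[R]_n) (s : 'cV[R]_k) :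
  0 < M ->
  (forall i l, `|B i l - M * Pi i l| <= 1) ->
  (forall i, `|b i 0 - M * (Pi *m w0) i 0| <= 1) ->
  near_solution B b x s ->
  forall i, `|(Pi *m (col_mx x s - w0)) i 0| <=
    (2 * (n + k).+1%:R + norm1 x^T) / M.
Proof.
move=> M_gt0 BPi bPi [Bw s01] i; set w := col_mx x s in Bw *.
rewrite ler_pdivlMr // -{1}(gtr0_norm M_gt0) -normrM mulrC.
have -> : M * (Pi *m (w - w0)) i 0 =
    (B *m w - b) i 0 - ((B - M *: Pi) *m w) i 0 + (b i 0 - M * (Pi *m w0) i 0).
  rewrite mulmxBr mulmxBl -scalemxAl ![fun_of_matrix (_ - _) i 0]mxE.
  rewrite ![fun_of_matrix (- _) i 0]mxE ![fun_of_matrix (_ *: _) i 0]mxE; ring.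
have BPi1 i1 i2 : `|(B - M *: Pi) i1 i2| <= 1.
  by have := BPi i1 i2; rewrite !mxE.
have wle : norm1 w^T <= norm1 x^T + k%:R.
  rewrite tr_col_mx norm1_row_mx lerD2l norm1_tr_le // => l.
  by have /andP[? ?] := s01 l; rewrite ger0_norm.
have k_le : k%:R + 1 <= (n + k).+1%:R :> R by rewrite natr1 ler_nat ltnS leq_addl.
rewrite (le_trans (ler_normD _ _)) // (le_trans (lerD (ler_normB _ _) (bPi i))) //.
have := Bw i; have := mulmx_entry_le w BPi1 i; lra.
Qed.

(** The lower bound on [M] lets the term in [norm1 x^T] enter its own estimate with coefficient 1/2
    only, so it can be solved for. Substituting the bound turns the residual into
    [(6 * (n + k) + 4) / M]. *)
Lemma near_solution_support (R : realFieldType) (n k q : nat) (U : 'M[R]_(n, q))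
    (S : 'M[R]_(k, q)) (Pi B : 'M[R]_(n + k)) (b : 'cV[R]_(n + k)) (M : R) (j0 : 'I_q) :
  lifting U S ->
  (forall j, Pi *m (col j (col_mx U S) - col j0 (col_mx U S)) = 0) ->
  (forall g : 'rV_(n + k),
     (forall j, g *m (col j (col_mx U S) - col j0 (col_mx U S)) = 0) ->
     g *m Pi = g) ->
  (forall i l, `|B i l - M * Pi i l| <= 1) ->
  (forall i, `|b i 0 - M * (Pi *m col j0 (col_mx U S)) i 0| <= 1) ->
  0 < M -> 2 * n%:R * k.+1%:R <= M ->
  forall (x : 'cV[R]_n) (s : 'cV[R]_k), near_solution B b x s ->
  norm1 x^T <= 4 * (n + k)%:R + 2 /\
  forall (c : 'rV[R]_n) (beta : R), (forall j, (c *m U) 0 j <= beta) ->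
    (c *m x) 0 0 <= beta + k.+1%:R * (6 * (n + k)%:R + 4) / M * norm1 c.
Proof.
move=> liftUS PiD gPi BPi bPi M_gt0 M_ge x s sol.
have s_ge0 i : 0 <= s i 0 by case: sol => _ /(_ i) /andP[].
have res := near_solution_residual M_gt0 BPi bPi sol.
have supp := lifting_support liftUS PiD gPi s_ge0 res.
have NE : (n + k).+1%:R = n%:R + k%:R + 1 :> R by rewrite -natr1 natrD.
have n_ge0 : 0 <= n%:R :> R by [].
have k_ge0 : 0 <= k%:R :> R by [].
(* The residual bound involves the norm of [x]; testing against the sign vector
   of [x] absorbs it. *)
have x_le : norm1 x^T <= 4 * (n + k)%:R + 2.
  pose c : 'rV_n := \row_i Num.sg (x i 0).
  have c1 i : `|c 0 i| <= 1 by rewrite mxE normr_sg; case: eqP.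
  have norm1c : norm1 c <= n%:R.
    by rewrite -[c]trmxK norm1_tr_le // => i; rewrite mxE.
  have cx : (c *m x) 0 0 = norm1 x^T.
    by rewrite mxE; apply: eq_bigr => i _; rewrite !mxE normrEsg.
  have cU j : (c *m U) 0 j <= n%:R.
    rewrite mxE (le_trans (ler_norm _)) // (le_trans (ler_norm_sum _ _ _)) //.
    rewrite -[n in leRHS]card_ord -sumr_const; apply: ler_sum => i _.
    rewrite normrM mulr_ile1 //.
    by have /andP[? ?] := lifting_box liftUS i j; rewrite ger0_norm.
  have := supp c _ cU; rewrite cx NE natrD; set X := norm1 x^T.
  have X_ge0 : 0 <= X := norm1_ge0 _.
  set Y := 2 * _ + X; have Y_ge0 : 0 <= Y by rewrite /Y; lra.
  have : k.+1%:R * norm1 c * (Y / M) <= Y / 2.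
    have -> : Y / 2 = M / 2 * (Y / M) by field; rewrite gt_eqF.
    rewrite ler_wpM2r ?divr_ge0 ?(ltW M_gt0) //.
    have := ler_wpM2l (ler0n R k.+1) norm1c; lra.
  by rewrite /Y; lra.
split=> // c beta cU; apply: le_trans (supp c beta cU) _; rewrite lerD2l.
rewrite -!mulrA ler_wpM2l // mulrC mulrA ler_wpM2r ?norm1_ge0 //.
rewrite ler_wpM2r ?invr_ge0 ?(ltW M_gt0) //.
by move: x_le; rewrite NE natrD; lra.
Qed.

(** * 0/1 polytopes and liftings from extended formulations *)

Definition points (n : nat) (X : {set 'cV[bool]_n}) : 'M[RR]_(n, #|X|) :=
  \matrix_(i, j) embed01 (enum_val j) i 0.

Lemma points_box (n : nat) (X : {set 'cV[bool]_n}) i j : 0 <= points X i j <= 1.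
Proof. by rewrite !mxE; case: (_ i 0); rewrite /= ler01 lexx. Qed.

Lemma conv01P (n : nat) (X : {set 'cV[bool]_n}) (x : 'cV[RR]_n) :
  conv01 X x <-> hull (points X) x.
Proof.
have colsum (lam : 'cV_#|X|) :
    points X *m lam = \sum_j lam j 0 *: embed01 (enum_val j).
  apply/colP => i; rewrite mxE summxE; apply: eq_bigr => j _.
  by rewrite [RHS]mxE [points X i j]mxE mulrC.
split=> [[lam [lam_ge0 [lam1 ->]]]|[lam [lam_ge0 lam1 ->]]].
  exists (\col_j lam (enum_val j)); split=> [j||].
  - by rewrite mxE lam_ge0 // enum_valP.
  - by rewrite -lam1 [RHS]big_enum_val; apply: eq_bigr => j _; rewrite mxE.
  - by rewrite colsum [LHS]big_enum_val; apply: eq_bigr => j _; rewrite mxE.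
(* Vectors outside [X] get the default weight 0. *)
pose lam' v := oapp (fun j => lam j 0) 0 [pick j | enum_val j == v].
have lam'E j : lam' (enum_val j) = lam j 0.
  rewrite /lam'; case: pickP => [l /eqP/enum_val_inj -> //|/(_ j)].
  by rewrite eqxx.
exists lam'; split=> [v _|]; first by rewrite /lam'; case: pickP => [j _|_] /=.
split; first by rewrite big_enum_val -lam1; apply: eq_bigr => j _; rewrite lam'E.
rewrite colsum [RHS]big_enum_val; apply: eq_bigr => j _; by rewrite lam'E.
Qed.

(** The simplex spanned by the points of [X] projects onto the polytope, so [xc] never takes its
    default value here. *)
Lemma conv01_has_ext_form (n : nat) (X : {set 'cV[bool]_n}) :
  has_ext_form (conv01 X) #|X|.
Proof.
exists #|X|, 1%N, (- 1%:M), 0, (const_mx 1), 1%:M, (points X).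
apply/seteqP; split=> [_ [lam [lam_ge0 lam1] <-]|x /conv01P[lam [lam_ge0 lam1 ->]]].
  apply/conv01P; exists lam; split=> // [j|].
    by have := lam_ge0 j; rewrite mulNmx mul1mx !mxE oppr_le0.
  move/matrixP/(_ 0 0): lam1; rewrite !mxE eqxx mulr1n => <-.
  by apply: eq_bigr => j _; rewrite mxE mul1r.
exists lam => //; split=> [j|]; first by rewrite mulNmx mul1mx !mxE oppr_le0.
apply/matrixP => i j; rewrite !ord1 !mxE eqxx mulr1n -[RHS]lam1.
by apply: eq_bigr => l _; rewrite mxE mul1r.
Qed.

Lemma has_ext_form_xc (n : nat) (X : {set 'cV[bool]_n}) :
  has_ext_form (conv01 X) (xc (conv01 X)).
Proof.
rewrite /xc; case: pselect => [h|[]]; first by case: ex_minnP => k /asboolP.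
by exists #|X|; apply/asboolP; exact: conv01_has_ext_form.
Qed.

Lemma col_hull (R : realFieldType) (n q : nat) (U : 'M[R]_(n, q)) (j : 'I_q) :
  hull U (col j U).
Proof.
exists (delta_mx j 0); split; last by rewrite colE.
  by move=> i; rewrite mxE; case: eqP; rewrite ?ler01.
rewrite (bigD1 j) //= mxE !eqxx big1 ?addr0 // => i /negPf ij.
by rewrite mxE ij.
Qed.

(** Each vertex gets a preimage [z j], and its slacks in [C z <= c] are divided by their maxima.
    Affine combinations of the [z j] keep [D z = d], and nonnegative combined slacks mean
    [C z <= c], so they project into the hull. *)
Lemma has_ext_form_lifting (n k q : nat) (U : 'M[RR]_(n, q)) :
  (forall i j, 0 <= U i j <= 1) -> has_ext_form (hull U) k ->
  exists S : 'M[RR]_(k, q), lifting U S.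
Proof.
move=> U01 [m [l [C [c [D [d [pi piP]]]]]]].
have /fin_all_exists2[z zC zD] : forall j, exists2 z : 'cV_m,
    (forall i, (C *m z) i 0 <= c i 0) & D *m z = d /\ pi *m z = col j U.
  move=> j; have := col_hull U j; rewrite -piP => -[z [zC zD] piz].
  by exists z.
pose Z := \matrix_(i, j) z j i 0.
have colZ j : col j Z = z j by apply/colP => i; rewrite !mxE.
pose S0 i j := c i 0 - (C *m z j) i 0.
have S0_ge0 i j : 0 <= S0 i j by rewrite subr_ge0.
have [q0|q_gt0] := posnP q.
  exists 0; split=> [//|i j|i|mu mu1].
  - by rewrite mxE ler01 lexx.
  - by right=> j; rewrite mxE.
  - move: mu1; rewrite big1 => [/eqP|j _]; first by rewrite eq_sym oner_eq0.
    by have := ltn_ord j; rewrite [X in (_ < X)%N]q0.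
have /fin_all_exists[jm jmP] : forall i, exists jm, forall j, S0 i j <= S0 i jm.
  move=> i; case: (@arg_maxP _ _ _ (Ordinal q_gt0) xpredT (S0 i)) => // jm _ jmP.
  by exists jm => j; exact: jmP.
(* If the maximum is 0 the whole row vanishes, and division by 0 returns 0 as well. *)
exists (\matrix_(i, j) (S0 i j / S0 i (jm i))); split=> // [i j|i|mu mu1 Smu].
- rewrite mxE divr_ge0 //=; have [->|S0i] := eqVneq (S0 i (jm i)) 0.
    by rewrite invr0 mulr0 ler01.
  by rewrite ler_pdivrMr ?mul1r // lt0r S0i /=.
- have [S0i|S0i] := eqVneq (S0 i (jm i)) 0; last first.
    by left; exists (jm i); rewrite mxE divff.
  by right=> j; rewrite mxE S0i invr0 mulr0.
- have cst (r : nat) (v : 'cV[RR]_r) (A : 'M_(r, q)) :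
      (forall j, col j A = v) -> A *m mu = v.
    move=> Av; apply/colP => i; rewrite mxE -[RHS]mulr1 -mu1 mulr_sumr.
    by apply: eq_bigr => j _; rewrite -(Av j) [in RHS]mxE.
  rewrite -piP; exists (Z *m mu); last first.
    rewrite mulmxA; congr (_ *m _); apply/matrixP => i j.
    have [_ /colP/(_ i)] := zD j; rewrite -colZ !colE mulmxA -colE mxE => ->.
    by rewrite -colE mxE.
  split=> [i|].
    rewrite mulmxA -subr_ge0.
    have -> : c i 0 - (C *m Z *m mu) i 0 = \sum_j S0 i j * mu j 0.
      rewrite -[c i 0]mulr1 -mu1 mulr_sumr mxE -sumrB.
      apply: eq_bigr => j _; rewrite -mulrBl; congr ((_ - _) * _).
      by rewrite -colZ colE mulmxA -colE [RHS]mxE.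
    have -> : \sum_j S0 i j * mu j 0 =
        S0 i (jm i) * \sum_j (S0 i j / S0 i (jm i)) * mu j 0.
      rewrite mulr_sumr; apply: eq_bigr => j _; rewrite mulrA.
      have [S0i|S0i] := eqVneq (S0 i (jm i)) 0; last first.
        by rewrite [S0 i (jm i) * _]mulrC divfK.
      rewrite S0i mul0r; have := jmP i j; rewrite S0i => S0ij.
      have -> : S0 i j = 0 by apply/eqP; rewrite eq_le S0ij S0_ge0.
      by rewrite mul0r.
    rewrite mulr_ge0 //; have := Smu i; rewrite mxE.
    by under eq_bigr do rewrite mxE.
  rewrite mulmxA; apply: cst => j; have [zDj _] := zD j.
  by rewrite -zDj -colZ !colE mulmxA.
Qed.

(** * Encoding lengths, powers of two and rounding *)

Lemma enc_rat_int (z : int) (t : nat) : (`|z| <= 2 ^ t)%N ->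
  (enc_rat z%:~R <= t + 3)%N.
Proof.
move=> zt; rewrite /enc_rat numq_int denq_int.
have : (up_log 2 (`|z| + 1) <= t.+1)%N.
  by apply: up_log_min => //; rewrite expnS; have := expn_gt0 2 t; lia.
have -> : up_log 2 (`|1%Z| + 1) = 1%N by [].
by lia.
Qed.

Lemma enc_mx_int (m r t : nat) (A : 'M[int]_(m, r)) :
  (forall i j, (`|A i j| <= 2 ^ t)%N) -> (enc_mx (map_mx intr A) <= m * r * (t + 4))%N.
Proof.
move=> At; rewrite /enc_mx (_ : t + 4 = 1 + (t + 3))%N; last by lia.
rewrite mulnDr muln1 leq_add2l.
rewrite -[in leqRHS](card_ord m) -[in leqRHS](card_ord r) -mulnA -!sum_nat_const.
apply: leq_sum => i _; apply: leq_sum => j _; rewrite mxE; exact: enc_rat_int.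
Qed.

(** About [2 * |ln (1 / eps)|] bits suffice, since [expR (1 / 2) <= 2]. The logarithm may be
    negative and a polynomial cannot contain its absolute value, so that is bounded through the
    square. *)
Lemma pow2_ge_inv (eps : RR) : 0 < eps ->
  exists2 T : nat, 1 <= eps * 2 ^+ T & T%:R <= ln (1 / eps) ^+ 2 + 3.
Proof.
move=> eps_gt0; set L := ln (1 / eps).
have expL : expR L = eps^-1 by rewrite /L lnK ?div1r // posrE invr_gt0.
pose T := (Num.truncn (2 * `|L|)).+1.
have T_gt : 2 * `|L| < T%:R by exact: truncnS_gt.
have T_le : (Num.truncn (2 * `|L|))%:R <= 2 * `|L| by rewrite truncn_le mulr_ge0.
exists T; last first.
  rewrite /T -natr1.
  have : `|L| ^+ 2 = L ^+ 2 by rewrite real_normK ?num_real.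
  have := sqr_ge0 (`|L| - 1); nra.
rewrite -ler_pdivrMl // mulr1 -expL.
have half : expR (1 / 2) <= 2 :> RR.
  have := expR_ge1Dx (- (1 / 2) : RR); rewrite expRN => h.
  have := expR_gt0 (1 / 2 : RR) => e_gt0.
  have := ler_wpM2r (ltW e_gt0) h; rewrite mulVf ?gt_eqF //; lra.
apply: (@le_trans _ _ (expR (1 / 2 * T%:R))).
  by rewrite ler_expR; have := ler_norm L; lra.
by rewrite expRM_natr lerXn2r // ?nnegrE // expR_ge0.
Qed.

(** The near solutions form a convex set, so it is enough to know the vertices. *)
Lemma near_solution_hull (R : realFieldType) (n k q : nat) (U : 'M[R]_(n, q))
    (S : 'M[R]_(k, q)) (B : 'M[R]_(n + k)) (b : 'cV[R]_(n + k)) :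
  (forall j, near_solution B b (col j U) (col j S)) ->
  forall x, hull U x -> exists s, near_solution B b x s.
Proof.
move=> sol _ [lam [lam_ge0 lam1 ->]]; exists (S *m lam).
have avg (v : 'I_q -> R) t : (forall j, v j <= t) -> \sum_j v j * lam j 0 <= t.
  move=> vt; rewrite -[leRHS]mulr1 -lam1 mulr_sumr; apply: ler_sum => j _.
  by rewrite ler_wpM2r.
split=> i; last first.
  have S01 j : 0 <= S i j <= 1 by have [_ /(_ i)] := sol j; rewrite mxE.
  rewrite mxE sumr_ge0 /= => [|j _]; last by rewrite mulr_ge0 //; case/andP: (S01 j).
  by apply: avg => j; case/andP: (S01 j).
have -> : (B *m col_mx (U *m lam) (S *m lam) - b) i 0 =
    \sum_j (B *m col_mx (col j U) (col j S) - b) i 0 * lam j 0.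
  rewrite -mul_col_mx mulmxA [LHS]mxE [X in X + _]mxE [X in _ + X]mxE.
  rewrite -[b i 0]mulr1 -lam1 mulr_sumr -sumrB; apply: eq_bigr => j _.
  rewrite -mulrBl; congr (_ * _).
  rewrite -col_col_mx [RHS]mxE [fun_of_matrix (- _) i 0]mxE; congr (_ - _).
  by rewrite colE mulmxA -colE [RHS]mxE.
rewrite (le_trans (ler_norm_sum _ _ _)) //.
rewrite (eq_bigr (fun j => `|(B *m col_mx (col j U) (col j S) - b) i 0| * lam j 0)).
  by apply: avg => j; have [/(_ i)] := sol j.
by move=> j _; rewrite normrM (ger0_norm (lam_ge0 j)).
Qed.

Lemma floor_dist (R : archiRealFieldType) (x : R) : `|(Num.floor x)%:~R - x| <= 1.
Proof.
have := floor_le x; have := floorD1_gt x; rewrite intrD => ? ?.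
by rewrite ler_norml; lra.
Qed.

Lemma absz_floor_le (R : archiRealFieldType) (x : R) (K : nat) :
  `|x| <= K%:R -> (`|Num.floor x| <= K)%N.
Proof.
rewrite ler_norml => /andP[Kx xK].
have : - K%:Z <= Num.floor x by rewrite floor_ge_int mulrNz.
have : Num.floor x <= K%:Z.
  by rewrite -(ler_int R); apply: le_trans (floor_le x) xK.
lia.
Qed.

(** The left side is the total loss: the first two factors come from [near_solution_support], the
    last from [support_near_hull]. With [N = n.+1 + k < 2 ^ N] it is at most [16 * (2 ^ N) ^ 3]. *)
Lemma pow2_exponent_bound (n k : nat) :
  (k.+1 * (6 * (n.+1 + k) + 4) * n.+1 <= 2 ^ (3 * (n.+1 + k) + 4))%N.
Proof.
set N := (n.+1 + k)%N.
have NltN : (N < 2 ^ N)%N by exact: ltn_expl.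
rewrite expnD mulnC [(3 * N)%N]mulnC expnM -[(2 ^ 4)%N]/16%N.
set P := (2 ^ N)%N in NltN *.
have [kN nN N0] : [/\ k.+1 <= N, n.+1 <= N & 0 < N]%N by rewrite /N; split; lia.
have : (k.+1 * n.+1 <= P * P)%N by apply: leq_mul; lia.
have : (6 * N + 4 <= 16 * P)%N by lia.
move=> h1 h2; have := leq_mul h1 h2; rewrite -[(P ^ 3)%N]/(P * (P * P))%N; lia.
Qed.

(** * The integer system and its description by inequalities *)

(** [Pi] is scaled by [2 ^ t] and rounded down. In [t], the part [3 * (n.+1 + k) + 4] pays for the
    loss factors and [T] for the accuracy [eps]. *)
Lemma rounded_system (n k q T : nat) (U : 'M[RR]_(n.+1, q)) (S : 'M[RR]_(k, q))
    (j0 : 'I_q) (eps : RR) :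
  lifting U S -> 1 <= eps * 2 ^+ T ->
  let t := (3 * (n.+1 + k) + 4 + T)%N in
  exists (B : 'M[int]_(n.+1 + k)) (b : 'cV[int]_(n.+1 + k)),
  [/\ forall i j, (`|B i j| <= 2 ^ t)%N,
      forall i j, (`|b i j| <= (n.+1 + k) * 2 ^ t)%N,
      forall x, hull U x ->
        exists s, near_solution (map_mx intr B) (map_mx intr b) x s,
      forall (x : 'cV[RR]_n.+1) s, near_solution (map_mx intr B) (map_mx intr b) x s ->
        norm1 x^T <= 4 * (n.+1 + k)%:R + 2
    & forall (x : 'cV[RR]_n.+1) s, near_solution (map_mx intr B) (map_mx intr b) x s ->
        exists2 p, hull U p & norm1 (x - p)^T <= eps].
Proof.
move=> liftUS epsT t; set W := col_mx U S.
(* The columns of [D] span the directions of the affine hull of the lifted vertices. *)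
pose D := W - \matrix_(i, j) W i j0.
have colD j : col j W - col j0 W = col j D by apply/colP => i; rewrite !mxE.
have [Pi [PiD gPi Pi1]] := orthogonal_projection D.
have {}PiD j : Pi *m (col j W - col j0 W) = 0.
  by rewrite colD colE mulmxA PiD mul0mx.
have {}gPi (g : 'rV_(n.+1 + k)) :
    (forall j, g *m (col j W - col j0 W) = 0) -> g *m Pi = g.
  move=> gD; apply: gPi; apply/rowP => j; have := gD j.
  by rewrite colD colE mulmxA -colE => /matrixP/(_ 0 0); rewrite !mxE.
have M_gt0 : 0 < 2 ^+ t :> RR by rewrite exprn_gt0.
have w01 i : `|col j0 W i 0| <= 1.
  rewrite !mxE; case: splitP => l _.
    by have /andP[? ?] := lifting_box liftUS l j0; rewrite ger0_norm.
  by have /andP[? ?] := lifting_slack liftUS l j0; rewrite ger0_norm.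
pose B := \matrix_(i, j) Num.floor (2 ^+ t * Pi i j).
pose b := \col_i Num.floor (2 ^+ t * (Pi *m col j0 W) i 0).
have BPi i j : `|map_mx intr B i j - 2 ^+ t * Pi i j| <= 1.
  by rewrite !mxE floor_dist.
have bPi i : `|map_mx intr b i 0 - 2 ^+ t * (Pi *m col j0 W) i 0| <= 1.
  by rewrite mxE [b i 0]mxE floor_dist.
have bound := pow2_exponent_bound n k.
have supp := near_solution_support liftUS PiD gPi BPi bPi M_gt0.
have M_ge : 2 * n.+1%:R * k.+1%:R <= 2 ^+ t :> RR.
  rewrite -!natrM -natrX ler_nat; apply: (@leq_trans (2 ^ (3 * (n.+1 + k) + 4))).
    by apply: leq_trans bound; rewrite mulnAC leq_mul // mulnC leq_mul //; lia.
  by rewrite leq_exp2l // leq_addr.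
exists B, b; split=> [i j|i j|x Ux|x s|x s] //.
- rewrite mxE absz_floor_le // natrX normrM ger0_norm ?(ltW M_gt0) //.
  by rewrite ler_piMr ?(ltW M_gt0).
- rewrite ord1 mxE absz_floor_le // natrM natrX normrM ger0_norm ?(ltW M_gt0) //.
  rewrite mulrC ler_wpM2r ?(ltW M_gt0) //.
  exact: le_trans (mulmx_entry_le _ Pi1 i) (norm1_tr_le w01).
- apply: near_solution_hull Ux => j.
  exact: near_solution_lift liftUS (PiD j) BPi bPi.
- by case/(supp M_ge).
- case/(supp M_ge) => _; apply: support_near_hull.
    by rewrite divr_ge0 ?(ltW M_gt0) // mulr_ge0 // addr_ge0 // mulr_ge0.
  rewrite mulrAC ler_pdivrMr //.
  apply: (@le_trans _ _ (2 ^+ (3 * (n.+1 + k) + 4))).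
    by move: bound; rewrite -(ler_nat RR) natrX !natrM natrD natrM.
  by rewrite /t (exprD _ (3 * (n.+1 + k) + 4)) mulrCA ler_peMr ?exprn_ge0.
Qed.

(* [tubeB B], [tubeC B] and [tubed b] are the rows of
   [-(n+k+1) <= B (x, y) - b <= n+k+1], [0 <= y <= 1], i.e. of [near_solution]. *)
Definition tubeB (n k : nat) (B : 'M[int]_(n + k)) :
    'M[int]_(n + k + (n + k) + (k + k), n) :=
  col_mx (col_mx (lsubmx B) (- lsubmx B)) (col_mx 0 0).

Definition tubeC (n k : nat) (B : 'M[int]_(n + k)) :
    'M[int]_(n + k + (n + k) + (k + k), k) :=
  col_mx (col_mx (rsubmx B) (- rsubmx B)) (col_mx 1%:M (- 1%:M)).

Definition tubed (n k : nat) (b : 'cV[int]_(n + k)) :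
    'cV[int]_(n + k + (n + k) + (k + k)) :=
  let r := const_mx (n + k).+1%:Z in
  col_mx (col_mx (b + r) (r - b)) (col_mx (const_mx 1) 0).

Lemma forall_col_mx_le (R : numDomainType) (m1 m2 : nat) (u u' : 'cV[R]_m1)
    (v v' : 'cV[R]_m2) :
  (forall i, col_mx u v i 0 <= col_mx u' v' i 0) <->
  (forall i, u i 0 <= u' i 0) /\ (forall i, v i 0 <= v' i 0).
Proof.
split=> [uv|[uu' vv'] i].
  split=> i; [have := uv (lshift _ i)|have := uv (rshift _ i)].
    by rewrite !col_mxEu.
  by rewrite !col_mxEd.
by rewrite !mxE; case: splitP.
Qed.

Lemma map_ratr_intr (m r : nat) (A : 'M[int]_(m, r)) :
  map_mx ratr (map_mx intr A) = map_mx intr A :> 'M[RR]_(m, r).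
Proof. by apply/matrixP => i j; rewrite !mxE ratr_int. Qed.

Lemma polyQ_tube (n k : nat) (B : 'M[int]_(n + k)) (b : 'cV[int]_(n + k)) x y :
  polyQ (map_mx intr (tubeB B)) (map_mx intr (tubeC B)) (map_mx intr (tubed b)) x y
  <-> near_solution (map_mx intr B) (map_mx intr b) x y.
Proof.
set w : 'cV[RR]_(n + k) := map_mx intr B *m col_mx x y.
have wE : w = map_mx intr (lsubmx B) *m x + map_mx intr (rsubmx B) *m y.
  by rewrite /w -[B in LHS]hsubmxK map_row_mx mul_row_col.
have lhsE : map_mx intr (tubeB B) *m x + map_mx intr (tubeC B) *m y =
    col_mx (col_mx w (- w)) (col_mx y (- y)).
  rewrite !map_col_mx !map_mx0 !map_mxN map_mx1 !mul_col_mx !mulNmx !mul0mx mul1mx.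
  by rewrite !add_col_mx !add0r -opprD -wE.
have rhsE : map_mx intr (tubed b) = col_mx
    (col_mx (map_mx intr b + const_mx (n + k).+1%:R)
            (const_mx (n + k).+1%:R - map_mx intr b))
    (col_mx (const_mx 1) 0) :> 'cV[RR]_(n + k + (n + k) + (k + k)).
  by rewrite /tubed !map_col_mx map_mxD map_mxB !map_const_mx.
rewrite /polyQ !map_ratr_intr lhsE.
transitivity (forall i, col_mx (col_mx w (- w)) (col_mx y (- y)) i 0 <=
    (map_mx intr (tubed b) : 'cV[RR]_(n + k + (n + k) + (k + k))) i 0).
  by split=> h i; have := h i; rewrite -map_ratr_intr [(map_mx ratr _) i 0]mxE.
rewrite rhsE !forall_col_mx_le /near_solution -/w; split.
  case=> [[wb bw] [y1 y0]]; split=> i.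
    have := wb i; have := bw i; rewrite !mxE ler_norml; lra.
  by have := y1 i; have := y0 i; rewrite !mxE; lra.
case=> wb y01; split; split=> i.
- by have := wb i; rewrite !mxE ler_norml; lra.
- by have := wb i; rewrite !mxE ler_norml; lra.
- by have := y01 i; rewrite !mxE; lra.
- by have := y01 i; rewrite !mxE; lra.
Qed.

(** * Norm comparisons and support functions *)

Lemma norm2_le_norm1 (n : nat) (z : 'cV[RR]_n) : norm2 z <= norm1 z^T.
Proof.
have z_ge0 := norm1_ge0 z^T.
rewrite -[leRHS]ger0_norm // -sqrtr_sqr /norm2 ler_wsqrtr // expr2.
rewrite {1}/norm1 mulr_suml; apply: ler_sum => i _.
rewrite mxE -[leLHS]ger0_norm ?sqr_ge0 // normrX expr2 ler_wpM2l //.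
by rewrite /norm1 (bigD1 i) //= mxE lerDl sumr_ge0.
Qed.

Lemma dotvE (n : nat) (c x : 'cV[RR]_n) : dotv c x = (c^T *m x) 0 0.
Proof. by rewrite mxE; apply: eq_bigr => i _; rewrite mxE. Qed.

Lemma dotv_le_norm (n : nat) (c z : 'cV[RR]_n) : dotv c z <= norm1 z^T * norm2 c.
Proof.
rewrite /dotv /norm1 mulr_suml; apply: ler_sum => i _.
rewrite (le_trans (ler_norm _)) // normrM mulrC mxE ler_wpM2l //.
rewrite -sqrtr_sqr /norm2 ler_wsqrtr // (bigD1 i) //= lerDl.
by rewrite sumr_ge0 // => j _; rewrite sqr_ge0.
Qed.

(** Splitting [c x = c (x - p) + c p] with [p] a near point of the hull bounds the first term by
    [eps * norm2 c] and the second by the supremum over the polytope. *)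
Lemma dotv_sup_le (n : nat) (X : {set 'cV[bool]_n}) (Q : set 'cV[RR]_n) (c : 'cV[RR]_n)
    (eps : RR) :
  Q !=set0 ->
  (forall x, Q x -> exists2 p, hull (points X) p & norm1 (x - p)^T <= eps) ->
  sup [set dotv c x | x in Q] - sup [set dotv c x | x in conv01 X] <= eps * norm2 c.
Proof.
move=> [x0 Qx0] Qnear; rewrite lerBlDr ge_sup //.
  by exists (dotv c x0), x0.
move=> _ [x /Qnear[p Pp xp] <-].
have -> : dotv c x = dotv c (x - p) + dotv c p.
  by rewrite !dotvE -[in LHS](subrK p x) mulmxDr mxE.
rewrite lerD //.
  by rewrite (le_trans (dotv_le_norm _ _)) // ler_wpM2r // sqrtr_ge0.
apply: ub_le_sup; last by exists p => //; exact/conv01P.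
(* [sup] dominates its members only for a set bounded above; vertex coordinates in [0,1] give the
   bound [norm1 c^T]. *)
exists (norm1 c^T) => _ [y /conv01P Py <-].
rewrite dotvE; apply: hull_le Py _ => j.
rewrite mxE ler_sum // => i _; rewrite (le_trans (ler_norm _)) // normrM.
by have /andP[? ?] := points_box i j; rewrite ler_piMr // ger0_norm.
Qed.

(** * Encoding length and assembly of the polytope *)

(** Every entry is an integer of absolute value at most [2 ^ (2 * t)], so it costs at most
    [2 * t + 4] with its position. The largest entries, [b] shifted by the tolerance, are at most
    [(2 * N + 1) * 2 ^ t], and [2 * N + 1 <= t < 2 ^ t]. *)
Lemma enc_tube_le (n k t : nat) (B : 'M[int]_(n.+1 + k)) (b : 'cV[int]_(n.+1 + k)) :
  (3 * (n.+1 + k) + 4 <= t)%N ->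
  (forall i j, (`|B i j| <= 2 ^ t)%N) ->
  (forall i j, (`|b i j| <= (n.+1 + k) * 2 ^ t)%N) ->
  (enc_mx (map_mx intr (tubeB B)) + enc_mx (map_mx intr (tubeC B)) +
   enc_mx (map_mx intr (tubed b)) <=
   (n.+1 + k + (n.+1 + k) + (k + k)) * (n.+1 + k).+1 * (2 * t + 4))%N.
Proof.
set N := (n.+1 + k)%N => t_ge Bt bt; set K := (2 ^ (2 * t))%N.
have t_lt : (t < 2 ^ t)%N by exact: ltn_expl.
have K_ge : ((N + N.+1) * 2 ^ t <= K)%N.
  by rewrite /K mul2n -addnn expnD leq_mul2r; apply/orP; right; lia.
have KB i j : (`|B i j| <= K)%N.
  by apply: leq_trans (Bt i j) (leq_trans _ K_ge); rewrite leq_pmull // addnS.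
have Kb i j : (`|b i j| + N.+1 <= K)%N.
  by apply: leq_trans K_ge; rewrite mulnDl leq_add // leq_pmulr // expn_gt0.
have K_gt0 : (0 < K)%N by rewrite expn_gt0.
have colK (m1 m2 p : nat) (A1 : 'M[int]_(m1, p)) (A2 : 'M[int]_(m2, p)) :
    (forall i j, (`|A1 i j| <= K)%N) -> (forall i j, (`|A2 i j| <= K)%N) ->
    forall i j, (`|col_mx A1 A2 i j| <= K)%N.
  by move=> A1K A2K i j; rewrite mxE; case: splitP.
have zeroK (m p : nat) i j : (`|(0%R : 'M[int]_(m, p)) i j| <= K)%N by rewrite mxE.
have oneK (p : nat) i j : (`|(1%:M%R : 'M[int]_p) i j| <= K)%N.
  by rewrite mxE; case: eqP.
have oppK (m p : nat) (A : 'M[int]_(m, p)) :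
    (forall i j, (`|A i j| <= K)%N) -> forall i j, (`|(- A)%R i j| <= K)%N.
  by move=> AK i j; rewrite mxE abszN.
have KBl i j : (`|lsubmx B i j| <= K)%N by rewrite mxE.
have KBr i j : (`|rsubmx B i j| <= K)%N by rewrite mxE.
have addK (x y : int) : (`|x| + `|y| <= K)%N -> (`|(x + y)%R| <= K)%N by lia.
have rK i j : (`|(b + const_mx N.+1%:Z)%R i j| <= K)%N.
  by rewrite mxE [const_mx _ _ _]mxE; apply/addK/Kb.
have rK' i j : (`|(const_mx N.+1%:Z - b)%R i j| <= K)%N.
  rewrite mxE [const_mx _ _ _]mxE; apply: addK.
  by rewrite addnC mxE abszN; apply: Kb.
have onesK (m : nat) (i : 'I_m) (j : 'I_1) : (`|const_mx 1%R i j : int| <= K)%N.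
  by rewrite mxE.
have encB : (enc_mx (map_mx intr (tubeB B)) <= _)%N := enc_mx_int
  (colK _ _ _ _ _ (colK _ _ _ _ _ KBl (oppK _ _ _ KBl))
                  (colK _ _ _ _ _ (zeroK _ _) (zeroK _ _))).
have encC : (enc_mx (map_mx intr (tubeC B)) <= _)%N := enc_mx_int
  (colK _ _ _ _ _ (colK _ _ _ _ _ KBr (oppK _ _ _ KBr))
                  (colK _ _ _ _ _ (oneK _) (oppK _ _ _ (oneK _)))).
have encd : (enc_mx (map_mx intr (tubed b)) <= _)%N := enc_mx_int
  (colK _ _ _ _ _ (colK _ _ _ _ _ rK rK') (colK _ _ _ _ _ (onesK _) (zeroK _ _))).
apply: leq_trans (leq_add (leq_add encB encC) encd) _.
by rewrite -!mulnDl -!mulnDr addn1.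
Qed.

Theorem theorem6 :
  exists p : poly3,
  forall (n : nat) (X : {set 'cV[bool]_n}) (eps : RR),
    (1 <= n)%N -> X != finset.set0 -> 0 < eps ->
    exists (B : 'M[rat]_(4 * xc (conv01 X) + 2 * n, n))
           (C : 'M[rat]_(4 * xc (conv01 X) + 2 * n, xc (conv01 X)))
           (d : 'cV[rat]_(4 * xc (conv01 X) + 2 * n)),
      boundedQ B C d /\
      ((enc_mx B + enc_mx C + enc_mx d)%N%:R
         <= eval3 p n%:R (xc (conv01 X))%:R (ln (1 / eps))) /\
      conv01 X `<=` projQ B C d /\
      projQ B C d `<=` ball_sum (conv01 X) eps /\
      (forall c : 'cV[RR]_n,
         sup [set dotv c x | x in projQ B C d]
         - sup [set dotv c x | x in conv01 X] <= eps * norm2 c).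
Proof.
(* With [N = n + k] there are at most [4 N] rows of at most [2 N] entries, each costing at most
   [6 N + 12 + 2 T]. Inserting [T <= c ^+ 2 + 3] and [N >= 1] gives [192 N ^ 3 + 16 N ^ 2 c ^ 2],
   expanded here in [n] and [k]. *)
pose p : poly3 :=
  [:: (192, (3, 0, 0)%N); (576, (2, 1, 0)%N); (576, (1, 2, 0)%N);
      (192, (0, 3, 0)%N); (16, (2, 0, 2)%N); (32, (1, 1, 2)%N); (16, (0, 2, 2)%N)].
have pE a b c : eval3 p a b c = 192 * (a + b) ^+ 3 + 16 * (a + b) ^+ 2 * c ^+ 2.
  by rewrite /eval3 !big_cons big_nil /=; ring.
exists p => -[//|n] X eps _ X_neq0 eps_gt0.
have j0 : 'I_#|X|.
  have X_gt0 : (0 < #|X|)%N by rewrite finset.card_gt0.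
  exact: Ordinal X_gt0.
have convE : conv01 X = hull (points X) by apply/seteqP; split=> x /conv01P.
have [S liftXS] : exists S : 'M_(xc (conv01 X), _), lifting (points X) S.
  apply: has_ext_form_lifting; first exact: points_box.
  by rewrite -convE; exact: has_ext_form_xc.
move: (xc (conv01 X)) S liftXS => k S liftXS.
have [T epsT T_le] := pow2_ge_inv eps_gt0.
have := rounded_system j0 liftXS epsT; set t := (_ + T)%N => /=.
move=> [B [b [Bt bt hull_sol sol_le sol_near]]].
(* Two rows for each of the [n.+1 + k] equations and two for each of the [k] slack variables;
   rewriting backwards aligns the matrix types. *)
have <- : (n.+1 + k + (n.+1 + k) + (k + k) = 4 * k + 2 * n.+1)%N by lia.
exists (map_mx intr (tubeB B)), (map_mx intr (tubeC B)), (map_mx intr (tubed b)).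
set Q := projQ _ _ _.
have Qnear x : Q x -> exists2 p, hull (points X) p & norm1 (x - p)^T <= eps.
  by move=> [y /polyQ_tube]; exact: sol_near.
have PQ : conv01 X `<=` Q.
  by move=> x /conv01P/hull_sol[s ?]; exists s; exact/polyQ_tube.
split; [|split; [|split=> //; split]].
- exists (4 * (n.+1 + k)%:R + 2) => x y /polyQ_tube xy; split=> i.
    apply: le_trans (sol_le _ _ xy).
    by rewrite /norm1 (bigD1 i) //= mxE lerDl sumr_ge0.
  have [_ /(_ i)/andP[y0 y1]] := xy; rewrite ger0_norm // (le_trans y1) //.
  by have : 0 <= (n.+1 + k)%:R :> RR; [exact: ler0n | lra].
- rewrite pE -natrD; set N := (n.+1 + k)%N; set L := ln _ in T_le *.
  have t_ge : (3 * N + 4 <= t)%N by rewrite leq_addr.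
  apply: (@le_trans _ _ ((4 * N) * (2 * N) * (6 * N + 12 + 2 * T))%:R).
    rewrite ler_nat; apply: leq_trans (enc_tube_le t_ge Bt bt) _.
    apply: leq_mul; first by apply: leq_mul; rewrite /N; lia.
    by rewrite /t; lia.
  have N_ge1 : 1 <= N%:R :> RR by rewrite ler1n.
  rewrite !natrM (natrD _ _ (2 * T)) (natrD _ _ 12) !natrM.
  move: (N%:R : RR) N_ge1 => a a_ge1.
  have : a ^+ 2 * T%:R <= a ^+ 2 * (L ^+ 2 + 3) by rewrite ler_wpM2l // sqr_ge0.
  have : a ^+ 2 * 1 <= a ^+ 2 * a by rewrite ler_wpM2l // sqr_ge0.
  rewrite !exprS expr0 !mulr1; nra.
- move=> x /Qnear[q Pq xq]; exists q, (x - q); split; first exact/conv01P.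
  split; first exact: le_trans (norm2_le_norm1 _) xq.
  by rewrite addrC subrK.
- move=> c; apply: dotv_sup_le => //.
  by exists (col j0 (points X)); apply/PQ/conv01P/col_hull.
Qed.
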